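(* Let $M$ and $N$ be singular $(G,X)$-manifolds and let $f:M\to N$ be an a.e. $(G,X)$-morphism which is a local homeomorphism. Then $f$ preserves both the regular and the singular loci: $f(\mathrm{Reg}(M))\subset\mathrm{Reg}(N)$ and $f(\mathrm{Sing}(M))\subset\mathrm{Sing}(N)$.
   Context: $(G,X)$ is an analytical structure: $X$ is a connected, locally connected, Hausdorff topological space and $G$ is a group acting faithfully on $X$ by homeomorphisms such that for all $\phi_1,\phi_2\in G$ and every nonempty open $U\subset X$, if $\phi_1$ and $\phi_2$ agree on $U$ they agree on $X$. A $(G,X)$-atlas is an atlas of charts valued in open subsets of $X$ whose changes of charts are locally restrictions of elements of $G$; a $(G,X)$-morphism is a map which in such charts is locally the restriction of an element of $G$. A subset $U$ of a space $M$ is portly if it is open, dense and locally connected in $M$ (i.e. $W\cap U$ is connected for every open connected $W\subset M$). An almost everywhere (a.e.) $(G,X)$-structure on $M$ is given by a $(G,X)$-atlas on some portly subset of $M$. Any such a.e. structure has a maximal extension (extending both the portly domain and the atlas). A singular $(G,X)$-manifold is a locally connected Hausdorff second countable space $M$ endowed with a maximal a.e. $(G,X)$-structure; its regular locus $\mathrm{Reg}(M)$ is the portly subset on which this maximal structure is defined, and $\mathrm{Sing}(M)=M\setminus\mathrm{Reg}(M)$. An a.e. $(G,X)$-morphism $f:M\to N$ between singular $(G,X)$-manifolds is a continuous map for which there exist portly subsets $U\subset\mathrm{Reg}(M)$ and $V\subset\mathrm{Reg}(N)$ such that $f$ restricts to a $(G,X)$-morphism $U\to V$. *)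

(* Defs.v *)
From mathcomp Require Import all_boot all_classical topology.

Set Implicit Arguments.
Unset Strict Implicit.
Unset Printing Implicit Defensive.

Local Open Scope classical_set_scope.

Definition locally_connected (T : topologicalType) : Prop :=
  forall (x : T) (W : set T), open W -> W x ->
    exists V : set T, [/\ open V, connected V, V x & V `<=` W].

(* Only the values of f on A matter.  As A and B are open, the last clause is
   the continuity of the inverse bijection from B to A. *)
Definition open_homeo (S T : topologicalType) (A : set S) (B : set T)
    (f : S -> T) : Prop :=
  [/\ open A, open B, set_bij A B f, {within A, continuous f}
    & forall W : set S, open W -> W `<=` A -> open (f @` W)].

Definition local_homeo (S T : topologicalType) (f : S -> T) : Prop :=
  forall x : S, exists2 W : set S, W x & open_homeo W (f @` W) f.

Record analytical_structure (G : groupType) (X : topologicalType) := {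
  act : G -> X -> X;
  act1 : forall x, act 1%g x = x;
  actM : forall g h x, act (g * h)%g x = act g (act h x);
  act_continuous : forall g, continuous (act g);
  act_faithful : forall g, (forall x, act g x = x) -> g = 1%g;
  act_analytic : forall (g h : G) (U : set X), open U -> U !=set0 ->
    (forall x, U x -> act g x = act h x) -> forall x, act g x = act h x;
  model_connected : connected [set: X];
  model_locally_connected : locally_connected X;
  model_hausdorff : hausdorff_space X
}.

(* A partially defined map; values outside the domain are irrelevant. *)
Record chart (M X : Type) := Chart { dom : set M; chart_map :> M -> X }.

Definition is_chart (M X : topologicalType) (c : chart M X) : Prop :=
  open_homeo (dom c) (c @` dom c) c.

Definition restrict_chart (M X : Type) (U : set M) (c : chart M X) :=
  Chart (dom c `&` U) c.

Definition restrict_atlas (M X : Type) (U : set M) (A : set (chart M X)) :=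
  restrict_chart U @` A.

Section GXStructures.
Context (G : groupType) (X : topologicalType) (S : analytical_structure G X).

(* With f := id, this says that the change of charts from c to d is locally
   the restriction of an element of G. *)
Definition locally_in_group (M N : topologicalType) (f : M -> N)
    (c : chart M X) (d : chart N X) : Prop :=
  forall x, dom c x -> dom d (f x) ->
    exists g : G, \forall y \near x,
      [/\ dom c y, dom d (f y) & d (f y) = act S g (c y)].

Definition gx_atlas (M : topologicalType) (U : set M)
    (A : set (chart M X)) : Prop :=
  [/\ forall c, A c -> is_chart c,
      \bigcup_(c in A) dom c = U
    & forall c d, A c -> A d -> locally_in_group id c d].

Definition gx_morphism (M N : topologicalType)
    (U : set M) (A : set (chart M X)) (V : set N) (B : set (chart N X))
    (f : M -> N) : Prop :=
  set_fun U V f /\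
  forall c d, A c -> B d -> locally_in_group f c d.

Definition portly (M : topologicalType) (U : set M) : Prop :=
  [/\ open U, dense U
    & forall W : set M, open W -> connected W -> connected (W `&` U)].

Definition ae_structure (M : topologicalType) (U : set M)
    (A : set (chart M X)) : Prop :=
  portly U /\ gx_atlas U A.

Definition maximal_ae_structure (M : topologicalType) (U : set M)
    (A : set (chart M X)) : Prop :=
  ae_structure U A /\
  forall (U' : set M) (A' : set (chart M X)), ae_structure U' A' ->
    U `<=` U' -> A `<=` A' -> U' = U /\ A' = A.

Record singular_manifold := {
  space :> topologicalType;
  Reg : set space;
  atlas : set (chart space X);
  space_locally_connected : locally_connected space;
  space_hausdorff : hausdorff_space space;
  space_second_countable : @second_countable space;
  atlas_maximal : maximal_ae_structure Reg atlas
}.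

Arguments Reg : clear implicits.
Arguments atlas : clear implicits.

Definition Sing (M : singular_manifold) : set M := ~` Reg M.

Definition ae_morphism (M N : singular_manifold) (f : M -> N) : Prop :=
  continuous f /\
  exists (U : set M) (V : set N),
    [/\ portly U, U `<=` Reg M, portly V, V `<=` Reg N
      & gx_morphism U (restrict_atlas U (atlas M))
                    V (restrict_atlas V (atlas N)) f].

End GXStructures.

Arguments Reg {G X S} M : rename.
Arguments atlas {G X S} M : rename.
Arguments Sing {G X S} M.
Arguments ae_morphism {G X S} M N f.

(* Main.v *)
Require Import Defs.
From mathcomp Require Import all_boot all_classical topology.

Set Implicit Arguments.
Unset Strict Implicit.
Unset Printing Implicit Defensive.

Local Open Scope classical_set_scope.

(** The a.e. morphism condition, known only on a portly set [U], propagates to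
    all of [M]: around a point of [dom c] whose image lies in [dom d], take a
    connected open set [Y] on which [c] and [d \o f] are both defined.  On the
    connected set [Y `&` U] the map [d \o f] is locally of the form [g \o c],
    and by analyticity the element [g] cannot jump, so a single [g] serves for
    all of [Y `&` U]; since [Y `&` U] is dense in [Y] and the model space is
    Hausdorff, [d \o f = g \o c] on [Y] ([locally_in_group_extend]).  Hence [f]
    is a morphism for the full atlases of [M] and [N] ([ae_morphism_charts]).

    A maximal a.e. structure contains the domain of every chart that is
    compatible with its atlas, because enlarging the regular locus by an open
    set keeps it portly ([compatible_chart_regular]).  It therefore suffices to
    transport charts through the local homeomorphism [f]: a chart [c] at [x]
    gives the chart [c \o f^-1] at [f x], and a chart [d] at [f x] gives the
    chart [d \o f] at [x].  Both are compatible with the existing charts since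
    [f] is a morphism.  So [x] is regular exactly when [f x] is. *)

(** * Homeomorphisms between open sets *)

Lemma open_homeo_imageP (S T : topologicalType) (A : set S) (f : S -> T) :
  open_homeo A (f @` A) f <->
  [/\ open A, {in A &, injective f}, forall x, A x -> {for x, continuous f}
    & forall W : set S, open W -> W `<=` A -> open (f @` W)].
Proof.
split=> [[oA _ [_ finj _] fc fo]|[oA finj fc fo]].
  split=> // x Ax; move: fc; rewrite continuous_open_subspace// => fc.
  by apply: fc; rewrite inE.
split=> //; first exact: fo.
  by split=> // x Ax; exists x.
by rewrite continuous_open_subspace// => x /[!inE]; exact: fc.
Qed.

Lemma open_homeo_sub (S T : topologicalType) (A W : set S) (f : S -> T) :
  open W -> W `<=` A -> open_homeo A (f @` A) f -> open_homeo W (f @` W) f.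
Proof.
move=> oW WA /open_homeo_imageP[_ finj fc fo]; apply/open_homeo_imageP.
split=> //.
- by move=> x y /[!inE] Wx Wy; apply: finj; rewrite inE; exact: WA.
- by move=> x /WA; exact: fc.
- by move=> V oV VW; apply: fo => // x /VW/WA.
Qed.

Lemma open_homeo_comp (S T R : topologicalType) (A : set S) (B : set T)
    (f : S -> T) (g : T -> R) : set_fun A B f ->
  open_homeo A (f @` A) f -> open_homeo B (g @` B) g ->
  open_homeo A ((g \o f) @` A) (g \o f).
Proof.
move=> fAB /open_homeo_imageP[oA finj fc fo] /open_homeo_imageP[_ ginj gc go].
apply/open_homeo_imageP; split=> //.
- move=> x y xA yA /ginj efxy; apply: finj => //.
  by apply: efxy; rewrite inE; apply: fAB; rewrite -inE.
- move=> x Ax; apply: continuous_comp; first exact: fc.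
  by apply: gc; exact: fAB.
- move=> W oW WA; rewrite -image_comp; apply: go; first exact: fo.
  by move=> _ [x /WA Ax <-]; exact: fAB.
Qed.

Lemma open_homeo_inverse (S T : topologicalType) (A : set S) (f : S -> T)
    (e : T -> S) : {in A, cancel f e} ->
  open_homeo A (f @` A) f -> open_homeo (f @` A) (e @` (f @` A)) e.
Proof.
move=> fK /open_homeo_imageP[oA finj fc fo].
(* Images under the inverse are preimages under [f], hence open. *)
have eimage W : W `<=` f @` A -> e @` W = A `&` f @^-1` W.
  move=> WfA; apply/seteqP; split=> [_ [y Wy <-]|x [Ax Wfx]].
    have [x Ax fxy] := WfA _ Wy; subst y.
    by rewrite fK ?inE.
  by exists (f x) => //; rewrite fK ?inE.
apply/open_homeo_imageP; split.
- exact: fo.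
- move=> _ _ /[!inE] -[x Ax <-] [y Ay <-]; rewrite !fK ?inE//.
  by move=> ->.
- move=> _ [x Ax <-] B /=; rewrite fK ?inE// => Bx.
  apply: (@filterS _ _ _ (f @` (A `&` B^°))).
    move=> _ [y [Ay By] <-] /=; rewrite fK ?inE//.
    exact: interior_subset.
  apply: open_nbhs_nbhs; split.
    by apply: fo; [exact: openI (open_interior _)|move=> ? []].
  by exists x => //; split=> //; exact: nbhs_interior.
- move=> W oW WfA; rewrite eimage// openE => x [Ax Wfx].
  apply: filterI; first exact: open_nbhs_nbhs.
  by apply: fc => //; exact: open_nbhs_nbhs.
Qed.

(** * Portly sets and density *)

(** For [W] connected open, [W `&` U] is connected and dense in [W `&` V]: a
    clopen part [B] of [W `&` V] contains all of [W `&` U] as soon as it is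
    nonempty, and then its complement, being open and missing [U], is empty. *)
Lemma portly_superset (M : topologicalType) (U V : set M) :
  open V -> U `<=` V -> portly U -> portly V.
Proof.
move=> oV UV [oU dU cU]; split=> //.
  by move=> O O0 /(dU _ O0)[x [Ox /UV Vx]]; exists x.
move=> W oW cW B [b Bb] [C oC eC] [D cD eD].
have oB : open B by rewrite eC; apply: openI => //; exact: openI.
(* [B `&` U] is again cut out by [C] and [D], now inside [W `&` U]. *)
have BU : B `&` U = W `&` U.
  apply: (cU W oW cW).
  - exact: dU (ex_intro _ b Bb) oB.
  - exists C => //; rewrite eC; apply/seteqP.
    by split=> [x [[[? ?] ?] ?]|x [[? ?] ?]] //; do !split=> //; exact: UV.
  - exists D => //; rewrite eD; apply/seteqP.
    by split=> [x [[[? ?] ?] ?]|x [[? ?] ?]] //; do !split=> //; exact: UV.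
apply/seteqP; split=> [x|x WVx]; first by rewrite eC => -[].
apply: contrapT => nBx.
have [||y [[WVy nDy] Uy]] := dU ((W `&` V) `&` ~` D).
- by exists x; split=> // Dx; apply: nBx; rewrite eD.
- by apply: openI; [exact: openI|exact: closed_openC].
have [By _] : (B `&` U) y by rewrite BU; split=> //; case: WVy.
by apply: nDy; move: By; rewrite eD => -[].
Qed.

Lemma eq_of_dense (M X : topologicalType) (U : set M) (h k : M -> X) (x : M) :
  hausdorff_space X -> dense U ->
  {for x, continuous h} -> {for x, continuous k} ->
  (\forall y \near x, U y -> h y = k y) -> h x = k x.
Proof.
move=> hX dU hc kc hk; apply: hX => A B hxA kxB.
have hA : \forall y \near x, A (h y) by exact: hc.
have kB : \forall y \near x, B (k y) by exact: kc.
have /nbhs_interior nO : \forall y \near x,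
    [/\ A (h y), B (k y) & U y -> h y = k y].
  by apply: filterS3 hA kB hk.
have [y [/interior_subset[Ay By ehk] Uy]] :=
  dU _ (ex_intro _ x (nbhs_singleton nO)) (open_interior _).
by exists (h y); split=> //; rewrite (ehk Uy).
Qed.

(** * Maps that are locally given by the group *)

Section AnalyticStructure.
Context (G : groupType) (X : topologicalType) (S : analytical_structure G X).
Implicit Types M N : topologicalType.

Lemma actK g : cancel (act S g) (act S g^-1%g).
Proof. by move=> x; rewrite -actM mulVg act1. Qed.

(** Analyticity read in a chart: charts are open maps, so agreement near a
    point of the source is agreement on a nonempty open set of the model. *)
Lemma act_eq_near M (c : chart M X) (x : M) (g h : G) :
  is_chart c -> dom c x ->
  (\forall y \near x, act S g (c y) = act S h (c y)) ->
  forall p, act S g p = act S h p.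
Proof.
move=> /open_homeo_imageP[oc _ _ co] cx /nbhs_interior egh.
pose O : set M := [set y | act S g (c y) = act S h (c y)]^°.
apply: (act_analytic (U := c @` (dom c `&` O))).
- by apply: co => [|? []//]; exact: openI (open_interior _).
- by exists (c x), x => //; split=> //; exact: nbhs_singleton egh.
- by move=> _ [y [_ /interior_subset ey] <-].
Qed.

(** The points near which a given [g] works form an open set; by analyticity it
    is also closed in [Z], because near a limit point some [g'] works and the two
    must coincide. *)
Lemma locally_in_group_connected M (c : chart M X) (h : M -> X) (Z : set M) :
  is_chart c -> open Z -> connected Z -> Z `<=` dom c ->
  (forall z, Z z -> exists g : G, \forall y \near z, h y = act S g (c y)) ->
  exists g : G, forall z, Z z -> h z = act S g (c z).
Proof.
move=> cc oZ cZ Zc hZ.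
have [[z0 Zz0]|Z0] := pselect (Z !=set0); last first.
  by exists 1%g => z Zz; case: Z0; exists z.
have [g hg] := hZ _ Zz0; exists g.
pose P : set M := [set z : M | \forall y \near z, h y = act S g (c y)].
have oP : open P by rewrite openE => z; exact: nbhs_interior.
suff <- : Z `&` P = Z by move=> z [_ /nbhs_singleton].
apply: cZ.
- by exists z0.
- by exists P.
exists (closure P); first exact: closed_closure.
apply/seteqP; split=> z [Zz Pz]; split=> //; first exact: subset_closure.
have [g' hg'] := hZ _ Zz.
have /Pz[w [Pw [Zw ePw]]] : nbhs z (Z `&` [set y | h y = act S g' (c y)]^°).
  by apply: filterI; [exact: open_nbhs_nbhs|exact: nbhs_interior].
have egg' : forall p, act S g p = act S g' p.
  apply: (act_eq_near cc (Zc _ Zw)).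
  by apply: filterS2 Pw ePw => y /= <- <-.
by apply: filterS hg' => y ->; rewrite egg'.
Qed.

(** This is where portliness matters: connectedness of [Y `&` U] gives one
    group element for a whole neighbourhood [Y], and density of [U] carries the
    identity over to the points of [Y] outside [U]. *)
Lemma locally_in_group_extend M N (f : M -> N) (U : set M)
    (c : chart M X) (d : chart N X) :
  locally_connected M -> continuous f -> portly U ->
  is_chart c -> is_chart d ->
  (forall x, dom c x -> U x -> dom d (f x) ->
    exists g : G, \forall y \near x, d (f y) = act S g (c y)) ->
  locally_in_group S f c d.
Proof.
move=> lcM fc [oU dU cU] cc cd gU x cx dfx.
have /open_homeo_imageP[oc _ cc_cont _] := cc.
have /open_homeo_imageP[od _ cd_cont _] := cd.
have oW : open (dom c `&` f @^-1` dom d).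
  by apply: openI => //; apply: open_comp => // y _; exact: fc.
have [Y [oY cY Yx Yc]] := lcM x _ oW (conj cx dfx).
have [z [/Yc[]]//|z [/Yc[cz dfz] Uz]|g hg] :=
  locally_in_group_connected (h := d \o f) cc (openI oY oU) (cU _ oY cY).
  exact: gU.
exists g; apply: filterS (open_nbhs_nbhs (conj oY Yx)) => y Yy.
have [cy dfy] := Yc _ Yy; split=> //.
apply: (@eq_of_dense _ _ U (d \o f) (act S g \o c)) => //.
- exact: model_hausdorff S.
- by apply: continuous_comp; [exact: fc|exact: cd_cont].
- by apply: continuous_comp; [exact: cc_cont|exact: act_continuous].
- by apply: filterS (open_nbhs_nbhs (conj oY Yy)) => z Yz Uz; exact: hg.
Qed.

Lemma locally_in_group_sym M (c d : chart M X) :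
  locally_in_group S id c d -> locally_in_group S id d c.
Proof.
move=> cd x dx cx; have [g hg] := cd x cx dx; exists g^-1%g.
by apply: filterS hg => y [cy dy ->]; split=> //; rewrite actK.
Qed.

(** Adding [e] to the atlas gives an a.e. structure extending the maximal one,
    hence equal to it: the enlarged domain is portly because it is open and
    contains a portly set. *)
Lemma compatible_chart_regular M (U : set M) (A : set (chart M X))
    (e : chart M X) :
  maximal_ae_structure S U A -> is_chart e ->
  (forall c, A c -> locally_in_group S id c e) -> dom e `<=` U.
Proof.
move=> [[pU [Ac AU AA]] Amax] ce Ae.
suff [<- _] : U `|` dom e = U /\ A `|` [set e] = A by move=> x; right.
have oe : open (dom e) by case: ce.
apply: Amax; [split| |] => //.
- apply: portly_superset (pU) => //.
  by apply: openU => //; case: pU.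
- split.
  + by move=> c [/Ac//|->].
  + by rewrite bigcup_setU bigcup_set1 AU.
  + move=> c d [Ac'|->] [Ad|->].
    * exact: AA.
    * exact: Ae.
    * by apply: locally_in_group_sym; exact: Ae.
    * move=> x ex _; exists 1%g.
      by apply: filterS (open_nbhs_nbhs (conj oe ex)) => y ey; rewrite act1.
Qed.

End AnalyticStructure.

(** * Transporting charts through a local homeomorphism *)

Section LocalHomeo.
Context (G : groupType) (X : topologicalType) (S : analytical_structure G X).
Context (M N : singular_manifold S).

Lemma RegP (P : singular_manifold S) (x : P) :
  Reg P x -> exists2 c, atlas P c & dom c x.
Proof. by case: (atlas_maximal P) => -[_ [_ <- _]] _ [c Pc cx]; exists c. Qed.

Lemma atlas_is_chart (P : singular_manifold S) (c : chart P X) :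
  atlas P c -> is_chart c.
Proof. by case: (atlas_maximal P) => -[_ [cP _ _]] _; exact: cP. Qed.

Lemma ae_morphism_charts (f : M -> N) (c : chart M X) (d : chart N X) :
  ae_morphism M N f -> atlas M c -> atlas N d -> locally_in_group S f c d.
Proof.
move=> [fc [U [V [pU UM pV VN [fUV fcd]]]]] Mc Nd.
apply: (locally_in_group_extend (U := U)) => //.
- exact: space_locally_connected.
- exact: atlas_is_chart.
- exact: atlas_is_chart.
move=> x cx Ux dfx.
have Uc : restrict_atlas U (atlas M) (restrict_chart U c) by exists c.
have Vd : restrict_atlas V (atlas N) (restrict_chart V d) by exists d.
have [g hg] := fcd _ _ Uc Vd x (conj cx Ux) (conj dfx (fUV _ Ux)).
by exists g; apply: filterS hg => y [].
Qed.

(** The new chart at [f x] is [c \o e], where [e] inverts [f] on a neighbourhood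
    [Y] of [x] inside the domain of a chart [c].  At [f y] with [y] in [Y], the
    identity [d \o f = g \o c] near [y] becomes [c \o e = g^-1 \o d]. *)
Lemma local_homeo_reg (f : M -> N) (x : M) :
  ae_morphism M N f -> local_homeo f -> Reg M x -> Reg N (f x).
Proof.
move=> hf hloc /RegP[c Mc cx]; have [W Wx hW] := hloc x.
have cc := atlas_is_chart Mc.
have oWc : open (W `&` dom c) by apply: openI; [case: hW|case: cc].
have {hW} := open_homeo_sub oWc (@subIsetl _ _ _) hW.
have : (W `&` dom c) x by [].
have : W `&` dom c `<=` dom c by exact: subIsetr.
move: (W `&` dom c) => Y {W Wx oWc} Yc Yx hY.
have /open_homeo_imageP[oY finj _ fo] := hY.
have fK := pinvKV (fun=> x) finj; set e := 'pinv_(_) Y f in fK.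
apply: (compatible_chart_regular (atlas_maximal N)
  (e := Chart (f @` Y) (c \o e))).
- apply: (open_homeo_comp _ _ cc); last exact: open_homeo_inverse hY.
  by move=> _ [y Yy <-]; rewrite fK ?inE//; exact: Yc.
- move=> d Nd z dfy [y Yy /= fyz]; subst z.
  have [g hg] := ae_morphism_charts hf Mc Nd (Yc _ Yy) dfy; exists g^-1%g.
  (* [O] is open and contains [y]; its image is the neighbourhood of [f y] on
     which the change of charts is given by [g^-1]. *)
  pose O := [set z | [/\ dom c z, dom d (f z) & d (f z) = act S g (c z)]]^°.
  have ofO := fo _ (openI oY (open_interior _ : open O)) (@subIsetl _ _ _).
  have fOy : (f @` (Y `&` O)) (f y) by exists y.
  apply: filterS (open_nbhs_nbhs (conj ofO fOy)).
  move=> _ [z [Yz /interior_subset[cz dfz edc]] <-]; split=> //.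
    by exists z.
  by rewrite /= edc fK ?inE// actK.
- by exists x.
Qed.

(** The new chart at [x] is [d \o f], for a chart [d] at [f x]; its changes of
    charts with the atlas of [M] are the expressions of [f] in charts. *)
Lemma local_homeo_reg_inv (f : M -> N) (x : M) :
  ae_morphism M N f -> local_homeo f -> Reg N (f x) -> Reg M x.
Proof.
move=> hf hloc /RegP[d Nd dfx]; have [W Wx hW] := hloc x.
have cd := atlas_is_chart Nd.
set W' := W `&` f @^-1` dom d.
have oW' : open W'.
  apply: openI; first by case: hW.
  by apply: open_comp => [y _|]; [case: hf => fc _; exact: fc|case: cd].
apply: (compatible_chart_regular (atlas_maximal M) (e := Chart W' (d \o f))).
- apply: (open_homeo_comp _ _ cd) => [y []//|].
  exact: open_homeo_sub oW' (@subIsetl _ _ _) hW.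
- move=> c Mc y cy W'y; have [_ dfy] := W'y.
  have [g hg] := ae_morphism_charts hf Mc Nd cy dfy; exists g.
  by apply: filterS2 (open_nbhs_nbhs (conj oW' W'y)) hg => z W'z [].
- by split.
Qed.

End LocalHomeo.

Theorem corollary3p12 (G : groupType) (X : topologicalType)
    (S : analytical_structure G X) (M N : singular_manifold S) (f : M -> N)
    (hf : ae_morphism M N f) (hloc : local_homeo f) :
  f @` Reg M `<=` Reg N /\ f @` Sing M `<=` Sing N.
Proof.
split=> _ [x Mx <-]; first exact: local_homeo_reg.
by move=> /(local_homeo_reg_inv hf hloc).
Qed.
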